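(* Let $L$ be a lower bound on the minimum number of relocations of a block relocation problem (BRP) instance. Then Problem 2 is a relaxation of the BRP: every feasible solution of the BRP is a feasible solution of Problem 2, and its objective value with respect to Problem 2 is less than or equal to its objective value with respect to the BRP.
   Context: Setting (BRP). There are $S$ stacks and $B$ blocks labelled $1,\dots,B$; a smaller label means a higher priority. A configuration places blocks in the stacks, each stack being a finite vertical sequence of blocks; the initial configuration $\mathbb{C}$ contains every block exactly once. Stacks have a height limit $H$ (at most $H$ blocks per stack). A relocation takes the topmost block of a stack and puts it on top of a different stack (respecting the height limit). A retrieval removes the block of smallest label among those still present, and is allowed only if it is topmost in its stack. No block is directly retrievable in $\mathbb{C}$ (block $1$ is not topmost). BRP: the feasible solutions are the finite sequences of moves (relocations and retrievals) starting from $\mathbb{C}$ that retrieve all blocks; the objective value, to be minimized, is the number of relocations in the sequence. A direct blockage in a configuration is a pair of blocks such that one lies directly on top of the other in the same stack and the upper one has lower priority (larger label). Problem 2 (with parameter $L$): determine a sequence of moves, starting from $\mathbb{C}$, that retrieves all blocks (and contains at least $L$ relocations), so that after its first $L$ relocations and all applicable retrieval moves (those carried out before the next relocation), the sum of $L$ and the number of direct blockages in the resulting configuration is minimized. This sum is the objective value of Problem 2. *)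

(* Defs.v *)
From mathcomp Require Import all_boot.

Set Implicit Arguments.
Unset Strict Implicit.
Unset Printing Implicit Defensive.

Record min_problem (T : Type) := MinProblem {
  feasible : T -> Prop;
  objective : T -> nat
}.

Definition is_min_value (T : Type) (P : min_problem T) (m : nat) : Prop :=
  (exists2 s, feasible P s & objective P s = m) /\
  (forall s, feasible P s -> m <= objective P s).

Definition relaxation (T : Type) (Q P : min_problem T) : Prop :=
  forall s, feasible P s -> feasible Q s /\ objective Q s <= objective P s.

(* Blocks are natural numbers 1, ..., B; each stack lists its blocks from the
   topmost one (the head) to the bottom one. *)
Definition config (S : nat) := {ffun 'I_S -> seq nat}.

Definition blocks (S : nat) (c : config S) : seq nat := flatten (codom c).

Definition initial_config (S B H : nat) (c : config S) : Prop :=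
  [/\ perm_eq (blocks c) (iota 1 B),
      forall i, size (c i) <= H
    & forall i, ohead (c i) <> Some 1].

Variant move (S : nat) :=
  | Relocate of 'I_S & 'I_S (* source, target *)
  | Retrieve of 'I_S.

Definition is_relocation (S : nat) (m : move S) : bool :=
  if m is Relocate _ _ then true else false.

Definition legal (S H : nat) (c : config S) (m : move S) : bool :=
  match m with
  | Relocate i j => [&& i != j, c i != [::] & size (c j) < H]
  | Retrieve i => if c i is b :: _ then all (leq b) (blocks c) else false
  end.

(* Only meaningful when the move is legal in c. *)
Definition apply_move (S : nat) (c : config S) (m : move S) : config S :=
  match m with
  | Relocate i j =>
      [ffun k => if k == i then behead (c i)
                 else if k == j then take 1 (c i) ++ c j else c k]
  | Retrieve i => [ffun k => if k == i then behead (c i) else c k]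
  end.

Definition apply_moves (S : nat) (c : config S) (ms : seq (move S)) : config S :=
  foldl (@apply_move S) c ms.

Fixpoint legal_moves (S H : nat) (c : config S) (ms : seq (move S)) : bool :=
  if ms is m :: ms' then legal H c m && legal_moves H (apply_move c m) ms'
  else true.

Definition relocations (S : nat) (ms : seq (move S)) : nat :=
  count (@is_relocation S) ms.

(* Blocks leave a configuration only through retrievals, so all blocks have
   been retrieved exactly when the final configuration is empty. *)
Definition retrieves_all (S H : nat) (c : config S) (ms : seq (move S)) : Prop :=
  legal_moves H c ms /\ blocks (apply_moves c ms) = [::].

Definition BRP (S H : nat) (c : config S) : min_problem (seq (move S)) :=
  MinProblem (retrieves_all H c) (@relocations S).

(* Each pair of the zip consists of a block and the one directly below it. *)
Definition stack_blockages (s : seq nat) : nat :=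
  count (fun p => p.2 < p.1) (zip s (behead s)).

Definition direct_blockages (S : nat) (c : config S) : nat :=
  \sum_(i < S) stack_blockages (c i).

(* The moves preceding the (L+1)-st relocation, or all moves if there is none:
   the first L relocations together with all retrievals carried out before the
   next relocation. *)
Fixpoint first_relocations (S L : nat) (ms : seq (move S)) : seq (move S) :=
  match ms with
  | [::] => [::]
  | m :: ms' =>
      if is_relocation m then
        if L is L'.+1 then m :: first_relocations L' ms' else [::]
      else m :: first_relocations L ms'
  end.

Definition problem2 (S H L : nat) (c : config S) : min_problem (seq (move S)) :=
  MinProblem
    (fun ms => retrieves_all H c ms /\ L <= relocations ms)
    (fun ms =>
       L + direct_blockages (apply_moves c (first_relocations L ms))).

(* Main.v *)
(* A relocation removes at most one direct blockage, namely the one between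
   the moved block and the block below it, and a retrieval removes none, since
   the retrieved block has the smallest label present. Hence the moves following
   the first L relocations contain at least as many relocations as there are
   direct blockages at that point. *)
Require Import Defs.
From mathcomp Require Import all_boot.

Set Implicit Arguments.
Unset Strict Implicit.
Unset Printing Implicit Defensive.

Lemma stack_blockages_cons2 (a b : nat) (s : seq nat) :
  stack_blockages [:: a, b & s] = (b < a) + stack_blockages (b :: s).
Proof. by []. Qed.

Lemma leq_stack_blockages_cons (a : nat) (s : seq nat) :
  stack_blockages s <= stack_blockages (a :: s).
Proof. by case: s => // b s; rewrite stack_blockages_cons2 leq_addl. Qed.

Lemma leq_stack_blockages_behead (s : seq nat) :
  stack_blockages s <= (stack_blockages (behead s)).+1.
Proof.
case: s => [|a [|b s]] //; rewrite stack_blockages_cons2.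
exact: leq_add (leq_b1 _) (leqnn _).
Qed.

Lemma mem_blocks (S : nat) (c : config S) (i : 'I_S) (b : nat) :
  b \in c i -> b \in blocks c.
Proof. by move=> cib; apply/flattenP; exists (c i); rewrite ?codom_f. Qed.

Lemma direct_blockages_empty (S : nat) (c : config S) :
  blocks c = [::] -> direct_blockages c = 0.
Proof.
move=> c0; apply: big1 => i _.
case ci: (c i) => [//|b s]; have := @mem_blocks _ c i b.
by rewrite ci c0 mem_head => /(_ isT).
Qed.

Lemma direct_blockages_apply_move (S H : nat) (c : config S) (m : move S) :
  legal H c m ->
  direct_blockages c <= is_relocation m + direct_blockages (apply_move c m).
Proof.
case: m => [i j|i] /=.
  (* The one relocation is charged to its source stack: with 1 written as a sum of indicators of
     [i], the inequality can be checked stack by stack. *)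
  have {1}<-: \sum_(k < S) (k == i) = 1.
    by rewrite (bigD1 i) //= eqxx big1 // => k /negbTE ->.
  move=> _; rewrite -big_split; apply: leq_sum => k _ /=; rewrite ffunE.
  have [->|_] := eqVneq k i; first exact: leq_stack_blockages_behead.
  have [->|//] := eqVneq k j.
  by case: (c i) => //= a s; rewrite take0; apply: leq_stack_blockages_cons.
case ci: (c i) => [//|b s] /allP b_min; apply: leq_sum => k _; rewrite ffunE.
have [->|//] := eqVneq k i; rewrite ci /=.
(* The block [a] under the retrieved [b] is still present, so [b <= a] and the pair is no
   blockage. *)
case: s ci => [//|a s] ci; rewrite stack_blockages_cons2 ltnNge b_min //.
by apply: (@mem_blocks _ _ i); rewrite ci !inE eqxx orbT.
Qed.

Lemma direct_blockages_le_relocations (S H : nat) (c : config S)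
    (ms : seq (move S)) :
  retrieves_all H c ms -> direct_blockages c <= relocations ms.
Proof.
elim: ms c => [|m ms IHms] c [] /=; first by move=> _ /direct_blockages_empty ->.
case/andP=> leg_m leg_ms empty.
apply: leq_trans (direct_blockages_apply_move leg_m) _.
by rewrite leq_add2l; apply: IHms.
Qed.

Lemma legal_moves_cat (S H : nat) (c : config S) (ms1 ms2 : seq (move S)) :
  legal_moves H c (ms1 ++ ms2) =
    legal_moves H c ms1 && legal_moves H (apply_moves c ms1) ms2.
Proof. by elim: ms1 c => //= m ms1 IH c; rewrite IH andbA. Qed.

Lemma first_relocations_prefix (S L : nat) (ms : seq (move S)) :
  exists ms', ms = first_relocations L ms ++ ms'.
Proof.
elim: ms L => [|m ms IHms] L; first by exists [::].
rewrite /=; case: ifP => _; last by have [ms' {1}->] := IHms L; exists ms'.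
(* With no relocation left to take, the prefix stops before [m], and everything from [m] on is the
   remainder. *)
case: L => [|L]; first by exists (m :: ms).
by have [ms' {1}->] := IHms L; exists ms'.
Qed.

(** Once [ms] has at least [L] relocations, this makes the summand [L] in the objective of Problem 2
    the exact number of relocations in the prefix. *)
Lemma relocations_first_relocations (S L : nat) (ms : seq (move S)) :
  relocations (first_relocations L ms) = minn L (relocations ms).
Proof.
rewrite /relocations; elim: ms L => [|m ms IHms] L /=; first by rewrite minn0.
case: ifP => mR /=; last by rewrite mR IHms.
by case: L => [|L] /=; rewrite ?min0n // mR IHms minnSS.
Qed.

(* Strong induction on the objective value replaces the existence of a
   minimum: a feasible value below L would be minimal. *)
Lemma min_value_lower_bound (T : Type) (P : min_problem T) (L : nat) :
  (forall m, is_min_value P m -> L <= m) ->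
  forall s, feasible P s -> L <= objective P s.
Proof.
move=> minL s; have [n] := ubnP (objective P s); elim: n s => // n IHn s.
rewrite ltnS => le_s_n fs; rewrite leqNgt; apply/negP => lt_s_L.
have: L <= objective P s.
  apply: minL; split=> [|t ft]; first by exists s.
  rewrite leqNgt; apply/negP => lt_t_s.
  have := IHn t (leq_trans lt_t_s le_s_n) ft.
  by rewrite leqNgt (ltn_trans lt_t_s lt_s_L).
by rewrite leqNgt lt_s_L.
Qed.

Theorem theorem7 (S B H : nat) (C : config S) (L : nat)
    (hC : initial_config B H C)
    (hL : forall m : nat, is_min_value (BRP H C) m -> L <= m) :
  relaxation (problem2 H L C) (BRP H C).
Proof.
(* This bound is the extra feasibility condition of Problem 2. *)
move=> ms feas_ms; have /= L_le := min_value_lower_bound hL feas_ms.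
split=> //=; have [ms' def_ms] := first_relocations_prefix L ms.
have := relocations_first_relocations L ms; rewrite (minn_idPl L_le).
(* From here on the prefix matters only through its [L] relocations and the splitting of [ms]. After
   cancelling [L], the remainder [ms'] has to pay for the blockages left after [ms1]. *)
move: (first_relocations L ms) def_ms feas_ms => ms1 -> [].
rewrite legal_moves_cat /apply_moves foldl_cat => /andP[_ leg_ms'] empty.
rewrite /relocations count_cat => ->; rewrite leq_add2l.
exact: direct_blockages_le_relocations (conj leg_ms' empty).
Qed.
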